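(* For a trace $\sigma$ with $n$ events, $T$ threads, $V$ variables (memory locations) and $L$ locks, the SHB vector clock algorithm run on $\sigma$ runs in time $O(nT\log n)$ and uses $O((V+L+T)\,T\log n)$ space.
   Context: **Traces.** A trace $\sigma$ is a finite sequence of events of the form $e=\langle t, op\rangle$, where $t$ is a thread and $op$ is one of $\mathtt{r}(x)$, $\mathtt{w}(x)$ (read/write of memory location $x$), $\mathtt{acq}(\ell)$, $\mathtt{rel}(\ell)$ (acquire/release of lock $\ell$), $\mathtt{fork}(u)$, $\mathtt{join}(u)$ (fork/join of thread $u$). Locks are not reentrant, and for every lock $\ell$ the subsequence of acquire and release events of $\ell$ is a prefix of a string in $\big(\bigcup_{t}\langle t,\mathtt{acq}(\ell)\rangle\cdot\langle t,\mathtt{rel}(\ell)\rangle\big)^*$. The threads, variables and locks counted by $T,V,L$ are those occurring in $\sigma$. **Vector times.** A vector time is a map $V:\mathsf{Threads}(\sigma)\to\mathbb{N}$. $V_1\sqsubseteq V_2$ iff $V_1(t)\le V_2(t)$ for all $t$; $V_1\sqcup V_2$ is the pointwise maximum; $V[n/u]$ agrees with $V$ except that it maps $u$ to $n$; $\bot$ is constantly $0$. **The SHB vector clock algorithm.** State: vector-time-valued variables $\mathbb{C}_t$ (each thread $t$), $\mathbb{L}_\ell$ (each lock $\ell$), $\mathbb{LW}_x,\mathbb{R}_x,\mathbb{W}_x$ (each location $x$). Initially $\mathbb{C}_t=\bot[1/t]$ and all others are $\bot$. Events are processed one at a time in trace order: - $\langle t,\mathtt{acq}(\ell)\rangle$: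 $\mathbb{C}_t:=\mathbb{C}_t\sqcup\mathbb{L}_\ell$. - $\langle t,\mathtt{rel}(\ell)\rangle$: $\mathbb{L}_\ell:=\mathbb{C}_t$; then $\mathbb{C}_t(t):=\mathbb{C}_t(t)+1$. - $\langle t,\mathtt{fork}(u)\rangle$: $\mathbb{C}_u:=\mathbb{C}_t[1/u]$; then $\mathbb{C}_t(t):=\mathbb{C}_t(t)+1$. - $\langle t,\mathtt{join}(u)\rangle$: $\mathbb{C}_t:=\mathbb{C}_t\sqcup\mathbb{C}_u$. - $\langle t,\mathtt{r}(x)\rangle$: if $\neg(\mathbb{W}_x\sqsubseteq\mathbb{C}_t)$ declare a race; then $\mathbb{C}_t:=\mathbb{C}_t\sqcup\mathbb{LW}_x$; $\mathbb{R}_x(t):=\mathbb{C}_t(t)$. - $\langle t,\mathtt{w}(x)\rangle$: if $\neg(\mathbb{R}_x\sqsubseteq\mathbb{C}_t)$ declare a race; if $\neg(\mathbb{W}_x\sqsubseteq\mathbb{C}_t)$ declare a race; then $\mathbb{LW}_x:=\mathbb{C}_t$; $\mathbb{W}_x(t):=\mathbb{C}_t(t)$; $\mathbb{C}_t(t):=\mathbb{C}_t(t)+1$. **Cost model.** Space is the number of bits used to store the state (vector clock components in binary); time is the number of bit operations, where comparing, joining, copying or updating a vector clock costs time linear in its bit size. *)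

(* Defs.v *)
From HB Require Import structures.
From mathcomp Require Import all_boot.

Set Implicit Arguments.
Unset Strict Implicit.
Unset Printing Implicit Defensive.

Inductive op (Th Var Lk : Type) : Type :=
| Read of Var
| Write of Var
| Acq of Lk
| Rel of Lk
| Fork of Th
| Join of Th.

Arguments Read {Th Var Lk}.
Arguments Write {Th Var Lk}.
Arguments Acq {Th Var Lk}.
Arguments Rel {Th Var Lk}.
Arguments Fork {Th Var Lk}.
Arguments Join {Th Var Lk}.

Definition event (Th Var Lk : Type) : Type := (Th * op Th Var Lk)%type.

Definition on_lock (Th Var : Type) (Lk : eqType) (l : Lk)
    (e : event Th Var Lk) : bool :=
  match e.2 with
  | Acq l' | Rel l' => l' == l
  | _ => false
  end.

(* [ts] lists the threads that hold [l], in order; [rest] completes the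
   acquire/release events of [l] to a full string of critical sections.  This
   rules out reentrant acquires. *)
Definition is_trace (Th Var : Type) (Lk : eqType)
    (sigma : seq (event Th Var Lk)) : Prop :=
  forall l : Lk, exists (ts : seq Th) (rest : seq (event Th Var Lk)),
    filter (on_lock l) sigma ++ rest
    = flatten [seq [:: (t, Acq l); (t, Rel l)] | t <- ts].

(* The target of a fork or a join occurs in the trace too. *)
Definition event_threads (Th Var Lk : Type) (e : event Th Var Lk) : seq Th :=
  match e.2 with
  | Fork u | Join u => [:: e.1; u]
  | _ => [:: e.1]
  end.

Definition event_vars (Th Var Lk : Type) (e : event Th Var Lk) : seq Var :=
  match e.2 with
  | Read x | Write x => [:: x]
  | _ => [::]
  end.

Definition event_locks (Th Var Lk : Type) (e : event Th Var Lk) : seq Lk :=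
  match e.2 with
  | Acq l | Rel l => [:: l]
  | _ => [::]
  end.

Definition threads (Th : eqType) (Var Lk : Type)
    (sigma : seq (event Th Var Lk)) : seq Th :=
  undup (flatten (map (@event_threads Th Var Lk) sigma)).

Definition vars (Th : Type) (Var : eqType) (Lk : Type)
    (sigma : seq (event Th Var Lk)) : seq Var :=
  undup (flatten (map (@event_vars Th Var Lk) sigma)).

Definition locks (Th Var : Type) (Lk : eqType)
    (sigma : seq (event Th Var Lk)) : seq Lk :=
  undup (flatten (map (@event_locks Th Var Lk) sigma)).

Definition vtime (Th : choiceType) (ths : seq Th) : Type :=
  {ffun seq_sub ths -> nat}.

Definition vbot (Th : choiceType) (ths : seq Th) : vtime ths := [ffun=> 0].

Definition vle (Th : choiceType) (ths : seq Th) (v1 v2 : vtime ths) : bool :=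
  [forall t, v1 t <= v2 t].

Definition vjoin (Th : choiceType) (ths : seq Th) (v1 v2 : vtime ths) :
    vtime ths :=
  [ffun t => maxn (v1 t) (v2 t)].

Definition vset (Th : choiceType) (ths : seq Th) (v : vtime ths) (u : Th)
    (n : nat) : vtime ths :=
  [ffun t => if val t == u then n else v t].

(* The default 0 is irrelevant: the algorithm only reads components of threads
   of the trace. *)
Definition vget (Th : choiceType) (ths : seq Th) (v : vtime ths) (u : Th) :
    nat :=
  if insub u is Some t then v t else 0.

(* Length of the binary expansion of [n], with one digit for 0. *)
Definition nbits (n : nat) : nat := (trunc_log 2 n).+1.

Definition vbits (Th : choiceType) (ths : seq Th) (v : vtime ths) : nat :=
  \sum_(t : seq_sub ths) nbits (v t).

Inductive reg (Th Var Lk : Type) : Type :=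
| RC of Th
| RL of Lk
| RLW of Var
| RR of Var
| RW of Var.

Arguments RC {Th Var Lk}.
Arguments RL {Th Var Lk}.
Arguments RLW {Th Var Lk}.
Arguments RR {Th Var Lk}.
Arguments RW {Th Var Lk}.

Definition reg_encode (Th Var Lk : Type) (r : reg Th Var Lk) :
    (Th + (Lk + (Var + (Var + Var))))%type :=
  match r with
  | RC t => inl t
  | RL l => inr (inl l)
  | RLW x => inr (inr (inl x))
  | RR x => inr (inr (inr (inl x)))
  | RW x => inr (inr (inr (inr x)))
  end.

Definition reg_decode (Th Var Lk : Type)
    (c : (Th + (Lk + (Var + (Var + Var))))%type) : reg Th Var Lk :=
  match c with
  | inl t => RC t
  | inr (inl l) => RL l
  | inr (inr (inl x)) => RLW x
  | inr (inr (inr (inl x))) => RR x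
  | inr (inr (inr (inr x))) => RW x
  end.

Lemma reg_encodeK (Th Var Lk : Type) :
  cancel (@reg_encode Th Var Lk) (@reg_decode Th Var Lk).
Proof. by case. Qed.

HB.instance Definition _ (Th Var Lk : eqType) :=
  Equality.copy (reg Th Var Lk) (can_type (@reg_encodeK Th Var Lk)).

Inductive scalar (Th Var Lk : Type) : Type :=
| One
| Comp of reg Th Var Lk & Th
| CompS of reg Th Var Lk & Th.

Arguments One {Th Var Lk}.

(* [Check e r r'] : if not (r [= r') then declare a race at e
   [JoinR r r']   : r := r |_| r'
   [CopyR r r']   : r := r'
   [SetR r r' u a]: r := r'[a/u]                                             *)
Inductive instr (Th Var Lk : Type) : Type :=
| Check of event Th Var Lk & reg Th Var Lk & reg Th Var Lk
| JoinR of reg Th Var Lk & reg Th Var Lk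
| CopyR of reg Th Var Lk & reg Th Var Lk
| SetR of reg Th Var Lk & reg Th Var Lk & Th & scalar Th Var Lk.

Definition event_code (Th Var Lk : Type) (e : event Th Var Lk) :
    seq (instr Th Var Lk) :=
  let t := e.1 in
  let incr := SetR (RC t) (RC t) t (CompS (RC t) t) in
  match e.2 with
  | Acq l => [:: JoinR (RC t) (RL l)]
  | Rel l => [:: CopyR (RL l) (RC t); incr]
  | Fork u => [:: SetR (RC u) (RC t) u One; incr]
  | Join u => [:: JoinR (RC t) (RC u)]
  | Read x => [:: Check e (RW x) (RC t);
                  JoinR (RC t) (RLW x);
                  SetR (RR x) (RR x) t (Comp (RC t) t)]
  | Write x => [:: Check e (RR x) (RC t);
                   Check e (RW x) (RC t);
                   CopyR (RLW x) (RC t);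
                   SetR (RW x) (RW x) t (Comp (RC t) t);
                   incr]
  end.

Definition program (Th Var Lk : Type) (sigma : seq (event Th Var Lk)) :
    seq (instr Th Var Lk) :=
  flatten (map (@event_code Th Var Lk) sigma).

Definition clocks (Th : choiceType) (Var Lk : Type) (ths : seq Th) : Type :=
  reg Th Var Lk -> vtime ths.

Record config (Th : choiceType) (Var Lk : Type) (ths : seq Th) : Type :=
  Config {
    clk : clocks Var Lk ths;
    races : seq (event Th Var Lk)  (* output: races declared so far *)
  }.

Definition init_clocks (Th : choiceType) (Var Lk : Type) (ths : seq Th) :
    clocks Var Lk ths :=
  fun r => if r is RC t then vset (vbot ths) t 1 else vbot ths.

Definition init_config (Th : choiceType) (Var Lk : Type) (ths : seq Th) :
    config Var Lk ths :=
  Config (@init_clocks Th Var Lk ths) [::].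

Definition set_reg (Th Var Lk : choiceType) (ths : seq Th)
    (c : clocks Var Lk ths) (r : reg Th Var Lk) (v : vtime ths) :
    clocks Var Lk ths :=
  fun r' => if r' == r then v else c r'.

Definition scalar_val (Th : choiceType) (Var Lk : Type) (ths : seq Th)
    (c : clocks Var Lk ths) (a : scalar Th Var Lk) : nat :=
  match a with
  | One => 1
  | Comp r t => vget (c r) t
  | CompS r t => (vget (c r) t).+1
  end.

Definition exec (Th Var Lk : choiceType) (ths : seq Th)
    (s : config Var Lk ths) (i : instr Th Var Lk) : config Var Lk ths :=
  let c := clk s in
  match i with
  | Check e r r' =>
      if vle (c r) (c r') then s else Config c (rcons (races s) e)
  | JoinR r r' => Config (set_reg c r (vjoin (c r) (c r'))) (races s)
  | CopyR r r' => Config (set_reg c r (c r')) (races s)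
  | SetR r r' u a =>
      Config (set_reg c r (vset (c r') u (scalar_val c a))) (races s)
  end.

(* The algorithm only accesses these; the others are not stored. *)
Definition regs (Th Var Lk : eqType) (sigma : seq (event Th Var Lk)) :
    seq (reg Th Var Lk) :=
  map RC (threads sigma) ++ map RL (locks sigma) ++ map RLW (vars sigma)
  ++ map RR (vars sigma) ++ map RW (vars sigma).

Definition state_bits (Th Var Lk : choiceType) (sigma : seq (event Th Var Lk))
    (c : clocks Var Lk (threads sigma)) : nat :=
  \sum_(r <- regs sigma) vbits (c r).

(* Total bit size of the vector clocks read and written by an instruction. *)
Definition instr_bits (Th Var Lk : choiceType) (ths : seq Th)
    (s : config Var Lk ths) (i : instr Th Var Lk) : nat :=
  let c := clk s in
  let c' := clk (exec s i) in
  match i with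
  | Check _ r r' => vbits (c r) + vbits (c r')
  | JoinR r r' => vbits (c r) + vbits (c r') + vbits (c' r)
  | CopyR r r' => vbits (c r') + vbits (c' r)
  | SetR r r' _ _ => vbits (c r') + vbits (c' r)
  end.

(* Costs are in bit operations; [init_cost] is for setting up the initial
   state. *)
Record cost_model (Th : choiceType) (Var Lk : Type) (ths : seq Th) : Type :=
  CostModel {
    init_cost : nat;
    instr_cost : config Var Lk ths -> instr Th Var Lk -> nat
  }.

Definition linear_cost (Th Var Lk : choiceType) (k : nat)
    (sigma : seq (event Th Var Lk))
    (m : cost_model Var Lk (threads sigma)) : Prop :=
  init_cost m <= k * state_bits (@init_clocks Th Var Lk (threads sigma))
  /\ forall s i, instr_cost m s i <= k * instr_bits s i.

Fixpoint run_time (Th Var Lk : choiceType) (ths : seq Th)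
    (m : cost_model Var Lk ths) (s : config Var Lk ths)
    (p : seq (instr Th Var Lk)) : nat :=
  if p is i :: p' then instr_cost m s i + run_time m (exec s i) p' else 0.

Fixpoint run_space (Th Var Lk : choiceType) (sigma : seq (event Th Var Lk))
    (s : config Var Lk (threads sigma)) (p : seq (instr Th Var Lk)) : nat :=
  if p is i :: p'
  then maxn (state_bits (clk s)) (run_space (exec s i) p')
  else state_bits (clk s).

Definition shb_time (Th Var Lk : choiceType) (sigma : seq (event Th Var Lk))
    (m : cost_model Var Lk (threads sigma)) : nat :=
  init_cost m + run_time m (init_config Var Lk (threads sigma)) (program sigma).

Definition shb_space (Th Var Lk : choiceType)
    (sigma : seq (event Th Var Lk)) : nat :=
  run_space (init_config Var Lk (threads sigma)) (program sigma).

(* Main.v *)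
Require Import Defs.
From mathcomp Require Import all_boot all_order all_algebra.
From mathcomp Require Import reals exp.
From mathcomp Require Import lra zify.

(** An event executes at most five vector clock instructions and increments at
    most one clock component, so no component ever exceeds [n + 1].  A vector
    clock thus takes [O(T log n)] bits throughout the run.  An instruction
    touches at most three clocks and there are [T + L + 3 V] of them, all of
    which have to be initialized; this initial cost is absorbed in the time
    bound because [T + L + 3 V <= 6 n]. *)

Set Implicit Arguments.
Unset Strict Implicit.
Unset Printing Implicit Defensive.

Import Order.TTheory GRing.Theory Num.Theory.

Lemma leq_nbits (m n : nat) : m <= n -> nbits m <= nbits n.
Proof. by move=> le_mn; rewrite /nbits ltnS leq_trunc_log. Qed.

Definition increments (Th Var Lk : Type) (i : instr Th Var Lk) : bool :=
  if i is SetR _ _ _ (CompS _ _) then true else false.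

(** The bound ranges over every register, not only over those in [regs sigma], so an instruction
    preserves it whatever registers it names. *)
Definition clocks_le (Th : choiceType) (Var Lk : Type) (ths : seq Th) (M : nat)
    (c : clocks Var Lk ths) : Prop :=
  forall r t, c r t <= M.

Section Bounds.
Variables (Th Var Lk : choiceType) (ths : seq Th).
Implicit Types (c : clocks Var Lk ths) (s : config Var Lk ths).
Implicit Types (i : instr Th Var Lk) (p : seq (instr Th Var Lk)).

Lemma vbits_le M (v : vtime ths) :
  (forall t, v t <= M) -> vbits v <= #|{: seq_sub ths}| * nbits M.
Proof.
move=> vM; rewrite -sum_nat_const /vbits.
by apply: leq_sum => t _; apply: leq_nbits.
Qed.

Lemma clocks_leW M N c : M <= N -> clocks_le M c -> clocks_le N c.
Proof. by move=> leMN cM r t; apply: leq_trans leMN. Qed.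

Lemma clocks_le_init : clocks_le 1 (@init_clocks Th Var Lk ths).
Proof. by case=> [u|l|x|x|x] t; rewrite /= !ffunE //; case: ifP. Qed.

Lemma vget_le M c r u : clocks_le M c -> vget (c r) u <= M.
Proof. by move=> cM; rewrite /vget; case: insub. Qed.

Lemma clocks_le_set M c r (v : vtime ths) :
  clocks_le M c -> (forall t, v t <= M) -> clocks_le M (set_reg c r v).
Proof. by move=> cM vM r' t; rewrite /set_reg; case: ifP. Qed.

(** Joins take maxima, copies and [Comp] reuse components already bounded by [M], and the constant
    [One] fits because [0 < M]. Only [CompS] can pass [M], and by one. *)
Lemma clocks_le_exec M s i : 0 < M -> clocks_le M (clk s) ->
  clocks_le (M + increments i) (clk (exec s i)).
Proof.
move=> M_gt0 cM; have cMi := clocks_leW (leq_addr (increments i) M) cM.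
case: i cMi => [e r r'|r r'|r r'|r r' u a] cMi /=.
- by case: ifP.
- by apply: clocks_le_set => // t; rewrite ffunE geq_max !cMi.
- exact: clocks_le_set.
- apply: clocks_le_set => // t; rewrite ffunE; case: ifP => // _.
  case: a {cMi} => [|q w|q w] /=; rewrite ?addn0 ?addn1 ?ltnS //;
  exact: vget_le.
Qed.

Lemma instr_bits_le M s i : 0 < M -> clocks_le M (clk s) ->
  instr_bits s i <= 3 * (#|{: seq_sub ths}| * nbits (M + increments i)).
Proof.
(* The bound after the step serves for the clocks read before it as well. *)
move=> M_gt0 cM; set b := _ * nbits _.
have old r : vbits (clk s r) <= b.
  by apply: vbits_le => t; apply: leq_trans (cM r t) (leq_addr _ _).
have new r : vbits (clk (exec s i) r) <= b.
  by apply: vbits_le => t; apply: clocks_le_exec.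
case: i @b old new => [e r r'|r r'|r r'|r r' u a] b old new; rewrite /instr_bits.
- by have := old r; have := old r'; lia.
- by have := old r; have := old r'; have := new r; lia.
- by have := old r'; have := new r; lia.
- by have := old r'; have := new r; lia.
Qed.

(** Induction with [M] general: each step adds to [M] exactly what it removes from the count of
    remaining increments. Their sum is thus constant along the run and bounds all components to
    come. *)
Lemma run_time_le (k : nat) (m : cost_model Var Lk ths) M s p :
  (forall s i, instr_cost m s i <= k * instr_bits s i) ->
  0 < M -> clocks_le M (clk s) ->
  run_time m s p <=
  size p * (k * (3 * (#|{: seq_sub ths}| * nbits (M + count (@increments _ _ _) p)))).
Proof.
move=> cost_le; elim: p M s => [//|i p IHp] M s M_gt0 cM /=.
rewrite mulSn leq_add //.
  apply: leq_trans (cost_le _ _) _; rewrite leq_mul2l; apply/orP; right.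
  apply: leq_trans (instr_bits_le _ M_gt0 cM) _.
  by rewrite !leq_mul // leq_nbits // leq_add2l leq_addr.
by rewrite addnA; apply: IHp; [rewrite ltn_addr | apply: clocks_le_exec].
Qed.

End Bounds.

Section Trace.
Variables (Th Var Lk : choiceType) (sigma : seq (event Th Var Lk)).
Let n := size sigma.
Let T := size (threads sigma).

Lemma size_undup_flatten_map (S : Type) (D : eqType) (f : S -> seq D) d s :
  (forall x, size (f x) <= d) -> size (undup (flatten (map f s))) <= d * size s.
Proof.
move=> fd; apply: leq_trans (size_undup _) _.
by elim: s => [//|x s IHs]; rewrite /= size_cat mulnS leq_add.
Qed.

(** The factor 2 comes from forks and joins, which mention a second thread. *)
Lemma size_threads : T <= 2 * n.
Proof. by apply: size_undup_flatten_map => -[t []]. Qed.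

Lemma size_vars : size (vars sigma) <= n.
Proof. by rewrite -[n]mul1n; apply: size_undup_flatten_map => -[t []]. Qed.

Lemma size_locks : size (locks sigma) <= n.
Proof. by rewrite -[n]mul1n; apply: size_undup_flatten_map => -[t []]. Qed.

Lemma size_regs :
  size (regs sigma) = T + size (locks sigma) + 3 * size (vars sigma).
Proof. by rewrite /regs !size_cat !size_map !mulSn addn0 !addnA. Qed.

(** Writes have the longest code, five instructions. *)
Lemma size_program : size (program sigma) <= 5 * n.
Proof.
rewrite /program /n; elim: sigma => [//|e s IHs].
by rewrite /= size_cat mulnS leq_add //; case: e => t [].
Qed.

Lemma count_increments_program :
  count (@increments _ _ _) (program sigma) <= n.
Proof.
rewrite /program /n; elim: sigma => [//|e s IHs].
by rewrite /= count_cat -add1n leq_add //; case: e => t [].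
Qed.

Lemma card_threads : #|{: seq_sub (threads sigma)}| = T.
Proof. by rewrite card_seq_sub ?undup_uniq. Qed.

Lemma state_bits_le M (c : clocks Var Lk (threads sigma)) :
  clocks_le M c -> state_bits c <= size (regs sigma) * (T * nbits M).
Proof.
move=> cM; rewrite /state_bits -card_threads -sum1_size big_distrl /=.
by apply: leq_sum => r _; rewrite mul1n; apply: vbits_le.
Qed.

Lemma run_space_le M (s : config Var Lk (threads sigma)) p :
  0 < M -> clocks_le M (clk s) ->
  run_space s p <=
  size (regs sigma) * (T * nbits (M + count (@increments _ _ _) p)).
Proof.
elim: p M s => [|i p IHp] M s M_gt0 cM /=.
  by rewrite addn0; apply: state_bits_le.
rewrite geq_max; apply/andP; split.
  by apply: state_bits_le; apply: clocks_leW cM; apply: leq_addr.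
by rewrite addnA; apply: IHp; [rewrite ltn_addr | apply: clocks_le_exec].
Qed.

Lemma shb_space_le :
  shb_space sigma <=
  3 * (size (vars sigma) + size (locks sigma) + T) * (T * nbits n.+1).
Proof.
(* Initial components are at most 1, so [M = 1] and at most [n] increments give [n.+1]. *)
apply: leq_trans
  (run_space_le (s := init_config Var Lk _) _ (ltn0Sn 0) (@clocks_le_init _ _ _ _)) _.
apply: leq_mul; first by rewrite size_regs; lia.
by rewrite leq_mul // leq_nbits // add1n ltnS count_increments_program.
Qed.

Lemma shb_time_le k (m : cost_model Var Lk (threads sigma)) :
  linear_cost k m -> shb_time m <= 21 * k * (n * (T * nbits n.+1)).
Proof.
move=> [init_le cost_le]; rewrite /shb_time.
(* Here 21 is 6 for initialization plus 5 instructions per event times 3 clocks per instruction. *)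
have -> : 21 * k * (n * (T * nbits n.+1)) =
  k * (6 * n * (T * nbits n.+1)) + 5 * n * (k * (3 * (T * nbits n.+1))) by lia.
apply: leq_add.
  apply: leq_trans init_le _; rewrite leq_mul2l; apply/orP; right.
  apply: leq_trans (state_bits_le (@clocks_le_init _ _ _ _)) _.
  apply: leq_mul; last by rewrite leq_mul // leq_nbits.
  (* The registers number at most [2 n + n + 3 n]. *)
  by rewrite size_regs; have := size_threads; have := size_vars;
     have := size_locks; lia.
apply: leq_trans (run_time_le (s := init_config Var Lk _) _ cost_le (ltn0Sn 0)
  (@clocks_le_init _ _ _ _)) _.
rewrite card_threads !leq_mul ?size_program //.
by rewrite leq_nbits // add1n ltnS count_increments_program.
Qed.

End Trace.

Local Open Scope ring_scope.

(* [2 ^ (nbits n.+1).-1 <= n.+1 <= n ^ 2] *)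
Lemma nbits_le_ln (R : realType) (n : nat) : (1 < n)%N ->
  (nbits n.+1)%:R <= 3 / ln 2 * ln n%:R :> R.
Proof.
move=> n_gt1; have ln2_gt0 : 0 < ln 2 :> R by rewrite ln_gt0 // ltr1n.
have n_gt0 : 0 < n%:R :> R by rewrite ltr0n ltnW.
(* This absorbs the extra digit in [nbits]: twice [ln n] for the truncated logarithm plus once for
   the digit gives the 3. *)
have ln2_le : ln 2 <= ln n%:R :> R by rewrite ler_ln ?posrE // ler_nat.
have le_exp : (2 ^ trunc_log 2 n.+1 <= n ^ 2)%N.
  have /leq_trans : (2 ^ trunc_log 2 n.+1 <= n.+1)%N by apply: trunc_logP.
  by apply; rewrite -mulnn; nia.
have : ln ((2 ^ trunc_log 2 n.+1)%:R : R) <= ln ((n ^ 2)%:R).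
  by rewrite ler_ln ?posrE ?ler_nat // ltr0n expn_gt0 // (ltnW n_gt1).
rewrite !natrX !lnXn // -[X in X <= _]mulr_natl -[X in _ <= X]mulr_natl => le_ln.
rewrite mulrAC ler_pdivlMr // /nbits -natr1 mulrDl mul1r; lra.
Qed.

Theorem theorem4p3 (R : realType) (k : nat) :
  exists K : R,
    forall (Th Var Lk : choiceType) (sigma : seq (event Th Var Lk))
           (m : cost_model Var Lk (threads sigma)),
      is_trace sigma -> linear_cost k m -> (1 < size sigma)%N ->
      let n : R := (size sigma)%:R in
      let T : R := (size (threads sigma))%:R in
      let V : R := (size (vars sigma))%:R in
      let L : R := (size (locks sigma))%:R in
      (shb_time m)%:R <= K * (n * T * ln n) /\
      (shb_space sigma)%:R <= K * ((V + L + T) * T * ln n).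
Proof.
(* The sum covers both the time constant [21 * k] and the space constant 3; [3 / ln 2] converts bit
   lengths into natural logarithms. *)
exists ((21 * k + 3)%:R * (3 / ln 2)) => Th Var Lk sigma m _ cost n_gt1 n T V L.
have le_K (a c : nat) (A : R) : (a <= 21 * k + 3)%N -> A = c%:R ->
    (a * (c * nbits (size sigma).+1))%:R <=
    (21 * k + 3)%:R * (3 / ln 2) * (A * ln n).
  move=> a_le ->; rewrite !natrM -mulrA [_ / _ * _]mulrCA.
  by rewrite ler_pM ?mulr_ge0 ?ler_nat // ler_wpM2l // nbits_le_ln.
split.
- apply: le_trans (le_K (21 * k)%N (size sigma * size (threads sigma))%N _ _ _).
  + by rewrite ler_nat -(mulnA (size sigma)) shb_time_le.
  + exact: leq_addr.
  + by rewrite natrM.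
- apply: le_trans (le_K 3%N ((size (vars sigma) + size (locks sigma)
                        + size (threads sigma)) * size (threads sigma))%N _ _ _).
  + by rewrite ler_nat -[(_ * _ * nbits _)%N]mulnA mulnA shb_space_le.
  + exact: leq_addl.
  + by rewrite natrM !natrD.
Qed.
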